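(* Let $p,n\geq 1$ be integers and let $0\leq\alpha<1$. If $f\in\mathcal{A}_{p,n}$ satisfies \[\operatorname{Re}\left(1+\frac{zf''(z)}{f'(z)}\right)<\frac{(p+n)\alpha+(2p+n)}{\alpha+2}\qquad\text{for all } z\in\mathbb{D},\] then \[\left|\frac{f'(z)}{pz^{p-1}}-1\right|<1+\alpha\qquad\text{for all } z\in\mathbb{D}.\]
   Context: $\mathbb{D}=\{z\in\mathbb{C}:|z|<1\}$ is the open unit disk. For positive integers $p,n$, $\mathcal{A}_{p,n}$ is the class of all analytic functions $f:\mathbb{D}\to\mathbb{C}$ whose power series at $0$ has the form $f(z)=z^{p}+a_{n+p}z^{n+p}+a_{n+p+1}z^{n+p+1}+\cdots$. Quotients are understood as meromorphic functions on $\mathbb{D}$ with removable singularities removed; so at $z=0$ the function $1+zf''(z)/f'(z)$ has value $p$ and $f'(z)/(pz^{p-1})$ has value $1$. An inequality assumed on $\mathbb{D}$ includes that the expression has no poles in $\mathbb{D}$. *)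

(* Defs.v *)
From Stdlib Require Import Reals.
From Coquelicot Require Import Coquelicot.
Open Scope R_scope.

Definition unit_disk (z : C) : Prop := Cmod z < 1.

(** Functions on the disk are represented by total functions [C -> C], of which
    only the values on [unit_disk] matter.  Differentiability is over the field
    [C]. *)
Definition analytic_on_disk (f : C -> C) : Prop :=
  forall z : C, unit_disk z -> ex_derive (K := C_AbsRing) (V := C_NormedModule) f z.

(** The class A_{p,n}: f(z) = z^p + sum_{k >= n+p} a_k z^k on the disk. *)
Definition class_A (p n : nat) (f : C -> C) : Prop :=
  analytic_on_disk f /\
  exists a : nat -> C, forall z : C, unit_disk z ->
    is_series (K := C_AbsRing) (V := C_NormedModule)
      (fun k : nat => (a (n + p + k)%nat * z ^ (n + p + k))%C)
      (f z - z ^ p)%C.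

(** [quotient_value F G z v]: the meromorphic function F/G has no pole at [z],
    and its value there, after removal of a removable singularity, is [v].  The
    value is the limit over the punctured neighbourhood, on which [G] has to be
    nonzero so that the junk values of [/] at 0 play no role. *)
Definition quotient_value (F G : C -> C) (z v : C) : Prop :=
  locally' z (fun w : C => G w <> RtoC 0) /\
  filterlim (fun w : C => (F w / G w)%C) (locally' z) (locally v).

(* Main.v *)
(** Put beta = 1 + alpha and write f'(z) = p z^(p-1) (1 + W(z)) with
    W(z) = z^n h(z), h a power series on the disk.  If |W(z1)| >= beta, let z0
    maximise |h| on the circle |z| = |z1|.  Jack's lemma makes
    z0 W'(z0) / W(z0) = k real with k >= n, so that
    Re (1 + z0 f''(z0)/f'(z0)) = p + Re (k W/(1 + W)) >= p + n beta/(1 + beta),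
    which is the forbidden value.

    Jack's lemma needs no Cauchy theory here.  With
    h(z0 u)/h(z0) = sum d_k u^k, bounded by 1 on |u| = 1 and equal to 1 at
    u = 1, the imaginary part of sum k d_k vanishes by first-order variation of
    u along the circle, and its real part is nonnegative because the Fejer means
    sum_(k <= K) (1 - k/(K+1)) d_k, being averages, have modulus at most 1; for
    polynomials these averages are finite sums over roots of unity. *)
Require Import Defs.
From Stdlib Require Import Reals Lra Lia.
From Coquelicot Require Import Coquelicot.
Open Scope R_scope.

(** * Roots of unity and Fejer means of polynomials *)

Definition cis (t : R) : C := (cos t, sin t).

Lemma cis_plus (s t : R) : cis (s + t) = (cis s * cis t)%C.
Proof.
  unfold cis, Cmult; simpl; rewrite cos_plus, sin_plus; f_equal; ring.
Qed.

Lemma cis_pow (t : R) (k : nat) : (cis t ^ k)%C = cis (INR k * t).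
Proof.
  induction k as [|k IH].
  - simpl; rewrite Rmult_0_l; unfold cis; rewrite cos_0, sin_0; reflexivity.
  - rewrite Cpow_S, IH, <- cis_plus; f_equal; rewrite S_INR; ring.
Qed.

Lemma cis_conj (t : R) : Cconj (cis t) = cis (- t).
Proof. unfold cis, Cconj; simpl; rewrite cos_neg, sin_neg; reflexivity. Qed.

Lemma Cmod_cis (t : R) : Cmod (cis t) = 1.
Proof.
  unfold Cmod, cis; cbn [fst snd].
  replace (cos t ^ 2 + sin t ^ 2) with 1; [apply sqrt_1|].
  generalize (sin2_cos2 t); unfold Rsqr; lra.
Qed.

(** The angle is [acos] of the real part, signed like the imaginary part. The compact range of
    angles is what [circle_max] needs. *)
Lemma unit_circle_cis (u : C) :
  Cmod u = 1 -> exists t : R, - PI <= t <= PI /\ u = cis t.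
Proof.
  intros hu.
  assert (h : fst u * fst u + snd u * snd u = 1).
  { assert (h2 : Cmod u ^ 2 = 1) by (rewrite hu; ring).
    rewrite Cmod2_alt in h2; unfold Re, Im in h2; lra. }
  assert (hx : -1 <= fst u <= 1) by nra.
  destruct (acos_bound (fst u)) as [h0 h1].
  assert (hs : sin (acos (fst u)) = Rabs (snd u)).
  { rewrite sin_acos by exact hx.
    replace (1 - (fst u)²) with ((snd u)²) by (unfold Rsqr; lra).
    apply sqrt_Rsqr_abs. }
  destruct (Rle_dec 0 (snd u)) as [hy | hy].
  - exists (acos (fst u)); split; [lra|].
    unfold cis; rewrite cos_acos, hs, Rabs_pos_eq by assumption.
    apply surjective_pairing.
  - exists (- acos (fst u)); split; [lra|].
    unfold cis; rewrite cos_neg, sin_neg, cos_acos, hs by assumption.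
    rewrite Rabs_left, Ropp_involutive by lra.
    apply surjective_pairing.
Qed.

Lemma cis_eq_1 (t : R) : cis t = 1 -> - (2 * PI) < t < 2 * PI -> t = 0.
Proof.
  intros h ht.
  assert (hc : cos t = 1) by (injection h; auto).
  (* The half-angle formula turns [cos t = 1] into [sin (t / 2) = 0], and sine has no zero strictly
     between 0 and [PI]. *)
  replace t with (2 * (t / 2)) in hc by field.
  rewrite cos_2a_sin in hc.
  assert (hs : sin (t / 2) = 0) by nra.
  destruct (Rtotal_order t 0) as [hn | [hz | hp]]; [|exact hz|].
  - assert (0 < sin (- (t / 2))) by (apply sin_gt_0; lra).
    rewrite sin_neg in *; lra.
  - assert (0 < sin (t / 2)) by (apply sin_gt_0; lra); lra.
Qed.

(* [sum_n] lands in [AbelianMonoid.sort C_AbelianMonoid], which [ring] does not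
   recognise as [C]. *)
Ltac cring := match goal with |- ?a = ?b => change (@eq C a b); ring end.

Lemma csum_S (a : nat -> C) (n : nat) :
  sum_n a (S n) = (sum_n a n + a (S n))%C.
Proof. exact (sum_Sn a n). Qed.

Lemma csum_0 (a : nat -> C) : sum_n a 0 = a 0%nat.
Proof. exact (sum_O a). Qed.

Lemma csum_mult_l (c : C) (a : nat -> C) (n : nat) :
  sum_n (fun k => (c * a k)%C) n = (c * sum_n a n)%C.
Proof. exact (sum_n_mult_l (K := C_Ring) c a n). Qed.

Lemma csum_mult_r (c : C) (a : nat -> C) (n : nat) :
  sum_n (fun k => (a k * c)%C) n = (sum_n a n * c)%C.
Proof. exact (sum_n_mult_r (K := C_Ring) c a n). Qed.

Lemma csum_conj (a : nat -> C) (n : nat) :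
  Cconj (sum_n a n) = sum_n (fun k => Cconj (a k)) n.
Proof.
  induction n as [|n IH]; [now rewrite !csum_0|].
  now rewrite !csum_S, Cplus_conj, IH.
Qed.

Lemma csum_const (c : C) (n : nat) :
  sum_n (fun _ => c) n = (INR (S n) * c)%C.
Proof.
  induction n as [|n IH]; [rewrite csum_0; simpl; cring|].
  rewrite csum_S, IH, (S_INR (S n)), RtoC_plus; cring.
Qed.

Lemma Cmod_csum (a : nat -> C) (n : nat) :
  Cmod (sum_n a n) <= sum_n (fun k => Cmod (a k)) n.
Proof. exact (norm_sum_n_m (V := C_NormedModule) a 0 n). Qed.

Lemma csum_geom (q : C) (n : nat) :
  (sum_n (fun j => (q ^ j)%C) n * (1 - q))%C = (1 - q ^ S n)%C.
Proof.
  induction n as [|n IH]; [rewrite csum_0; simpl; cring|].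
  rewrite csum_S, Cmult_plus_distr_r, IH, (Cpow_S q (S n)); cring.
Qed.

Lemma csum_delta (i n : nat) (x : C) :
  sum_n (fun j => if Nat.eqb i j then x else RtoC 0) n =
  if Nat.leb i n then x else RtoC 0.
Proof.
  induction n as [|n IH].
  - rewrite csum_0; destruct i; reflexivity.
  - rewrite csum_S, IH.
    destruct (Nat.leb_spec i n), (Nat.eqb_spec i (S n)),
      (Nat.leb_spec i (S n)); try lia; cring.
Qed.

Lemma csum_prefix (q n : nat) (x : C) : (q <= n)%nat ->
  sum_n (fun j => if Nat.leb j q then x else RtoC 0) n = (INR (S q) * x)%C.
Proof.
  intros h; induction h as [|n h IH].
  - rewrite <- csum_const; apply sum_n_ext_loc; intros j hj.
    now destruct (Nat.leb_spec j q); try lia.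
  - rewrite csum_S, IH; destruct (Nat.leb_spec (S n) q); try lia; cring.
Qed.

(** Roots of unity of order [L + 1], so that [sum_n _ L] runs over each of them once. *)
Definition unity_root (L j : nat) : C := cis (2 * PI * INR j / INR (S L)).

(** The summand is the [j]-th power of [cis t] with [t] equal to 2 pi (a - b) / (L + 1), so the sum
    is geometric. Since |a - b| < L + 1, the ratio is 1 only when [a = b]. *)
Lemma unity_root_orth (L a b : nat) : (a <= L)%nat -> (b <= L)%nat ->
  sum_n (fun j => (unity_root L j ^ a * Cconj (unity_root L j) ^ b)%C) L =
  if Nat.eqb a b then RtoC (INR (S L)) else RtoC 0.
Proof.
  intros ha hb.
  assert (hL : 0 < INR (S L)) by (apply lt_0_INR; lia).
  set (t := 2 * PI * (INR a - INR b) / INR (S L)).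
  assert (hE : forall j, (unity_root L j ^ a * Cconj (unity_root L j) ^ b)%C
                         = (cis t ^ j)%C).
  { intros j; unfold unity_root.
    rewrite cis_conj, !cis_pow, <- cis_plus; f_equal; unfold t; field; lra. }
  rewrite (sum_n_ext _ _ _ hE).
  destruct (Nat.eqb_spec a b) as [hab | hab].
  - subst b.
    assert (ht : cis t = 1).
    { unfold t; replace (2 * PI * (INR a - INR a) / INR (S L)) with 0
        by (field; lra).
      unfold cis; now rewrite cos_0, sin_0. }
    rewrite ht, (sum_n_ext _ (fun _ => RtoC 1)) by (intros; apply Cpow_1_l).
    rewrite csum_const; cring.
  - assert (hP := PI_RGT_0).
    assert (hA : INR a < INR (S L)) by (apply lt_INR; lia).
    assert (hB : INR b < INR (S L)) by (apply lt_INR; lia).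
    assert (hA0 := pos_INR a); assert (hB0 := pos_INR b).
    assert (hne : (1 - cis t)%C <> 0).
    { intros h.
      assert (ht : cis t = 1).
      { transitivity (1 - (1 - cis t))%C; [cring|rewrite h; cring]. }
      apply cis_eq_1 in ht.
      - apply hab, INR_eq.
        unfold t, Rdiv in ht.
        apply Rmult_integral in ht; destruct ht as [ht | ht].
        + nra.
        + exfalso; apply Rinv_neq_0_compat in ht; [exact ht|lra].
      - assert (ht2 : t = 2 * PI * ((INR a - INR b) / INR (S L)))
          by (unfold t; field; lra).
        assert (h1 : -1 < (INR a - INR b) / INR (S L) < 1).
        { split; [apply Rlt_div_r | apply Rlt_div_l]; lra. }
        rewrite ht2; nra. }
    assert (h := csum_geom (cis t) L).
    assert (hz : (cis t ^ S L)%C = 1).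
    { rewrite cis_pow.
      replace (INR (S L) * t) with (2 * PI * (INR a - INR b))
        by (unfold t; field; lra).
      replace (2 * PI * (INR a - INR b))
        with (0 + 2 * INR a * PI + - (0 + 2 * INR b * PI)) by ring.
      rewrite cis_plus, <- cis_conj; unfold cis.
      rewrite !cos_period, !sin_period, cos_0, sin_0.
      unfold Cconj, Cmult, RtoC; simpl; f_equal; ring. }
    rewrite hz in h.
    replace (1 - 1)%C with (RtoC 0) in h by cring.
    set (s := sum_n _ _) in *.
    rewrite <- (Cmult_1_r s), <- (Cinv_r _ hne), Cmult_assoc, h.
    apply Cmult_0_l.
Qed.

(** Expanding the squared modulus gives a double sum over [m] and [m']; orthogonality keeps the
    pairs with [k + m = m'], and there are [K - k + 1] of them. The choice of [L] makes room for
    exponents [k + m] up to twice [K]. *)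
Lemma fejer_moment (K k : nat) : (k <= K)%nat ->
  let L := (2 * K)%nat in
  sum_n (fun j => (unity_root L j ^ k *
     RtoC (Cmod (sum_n (fun m => (unity_root L j ^ m)%C) K) ^ 2))%C) L =
  (INR (S (K - k)) * INR (S L))%C.
Proof.
  intros hk L.
  set (w := unity_root L).
  transitivity (sum_n (fun j => sum_n (fun m => sum_n (fun m' =>
     (w j ^ (k + m) * Cconj (w j) ^ m')%C) K) K) L).
  { apply sum_n_ext; intros j.
    rewrite Cmod2_conj, csum_conj, <- csum_mult_r, <- csum_mult_l.
    apply sum_n_ext; intros m; rewrite <- !csum_mult_l.
    apply sum_n_ext; intros m'; rewrite Cpow_add_r, Cpow_conj; cring. }
  rewrite sum_n_switch.
  transitivity (sum_n (fun m => if Nat.leb m (K - k)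
     then RtoC (INR (S L)) else RtoC 0) K).
  { apply sum_n_ext_loc; intros m hm.
    rewrite sum_n_switch.
    rewrite (sum_n_ext_loc _ (fun m' => if Nat.eqb (k + m) m'
      then RtoC (INR (S L)) else RtoC 0)).
    - rewrite csum_delta.
      destruct (Nat.leb_spec (k + m) K), (Nat.leb_spec m (K - k));
        try lia; reflexivity.
    - intros m' hm'; apply unity_root_orth; unfold L; lia. }
  apply csum_prefix; lia.
Qed.

(* The weights [K + 1 - k] are the Fourier coefficients of the positive kernel
   [|1 + u + ... + u^K|^2], so the left-hand sum is an average of values of the
   polynomial on the circle, up to the total mass [K + 1]. *)
Lemma fejer_bound (d : nat -> C) (K : nat) (M : R) :
  (forall u, Cmod u = 1 -> Cmod (sum_n (fun k => (d k * u ^ k)%C) K) <= M) ->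
  Cmod (sum_n (fun k => (INR (S (K - k)) * d k)%C) K) <= INR (S K) * M.
Proof.
  intros hM.
  set (L := (2 * K)%nat); set (w := unity_root L).
  set (F := fun j => Cmod (sum_n (fun m => (w j ^ m)%C) K) ^ 2).
  assert (hL : 0 < INR (S L)) by (apply lt_0_INR; lia).
  assert (hF : forall j, 0 <= F j) by (intros; apply pow2_ge_0).
  assert (h1 : (INR (S L) * sum_n (fun k => INR (S (K - k)) * d k) K)%C =
    sum_n (fun j => sum_n (fun k => d k * w j ^ k) K * F j)%C L).
  { rewrite <- csum_mult_l.
    rewrite (sum_n_ext (fun j => (sum_n (fun k => d k * w j ^ k) K * F j)%C)
      (fun j => sum_n (fun k => (d k * (w j ^ k * F j))%C) K)).
    - rewrite (sum_n_switch (G := C_AbelianMonoid)).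
      apply sum_n_ext_loc; intros k hk.
      rewrite csum_mult_l.
      unfold F, w, L; rewrite (fejer_moment K k hk); cring.
    - intros j; rewrite <- csum_mult_r; apply sum_n_ext; intros k; cring. }
  (* The moment of order 0 is the total mass of the kernel. *)
  assert (h0 : sum_n F L = INR (S K) * INR (S L)).
  { assert (h := fejer_moment K 0 (Nat.le_0_l K)).
    cbv zeta in h.
    rewrite Nat.sub_0_r, <- RtoC_mult in h.
    fold L in h; apply RtoC_inj; rewrite <- h; clear h h1 hF.
    change (RtoC (sum_n F L) = sum_n (fun j => (w j ^ 0 * F j)%C) L).
    generalize L; intros N; induction N as [|N IH].
    - rewrite csum_0, sum_O; simpl; cring.
    - rewrite csum_S, sum_Sn, <- IH; unfold plus; simpl.
      rewrite RtoC_plus; cring. }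
  apply Rmult_le_reg_l with (INR (S L)); [exact hL|].
  rewrite <- (Rabs_pos_eq (INR (S L))) at 1 by lra.
  rewrite <- Cmod_R, <- Cmod_mult, h1.
  eapply Rle_trans; [apply Cmod_csum|].
  apply Rle_trans with (sum_n (fun j => M * F j) L).
  - apply (sum_n_m_le _ _ 0 L); intros j.
    rewrite Cmod_mult, Cmod_R, Rabs_pos_eq by apply hF.
    apply Rmult_le_compat_r; [apply hF|apply hM, Cmod_cis].
  - right; etransitivity; [exact (sum_n_mult_l (K := R_Ring) M F L)|].
    change (M * sum_n F L = INR (S L) * (INR (S K) * M)); rewrite h0; ring.
Qed.

(** * Complex series *)

Notation cseries := (is_series (K := C_AbsRing) (V := C_NormedModule)).

Lemma cseries_unique (a : nat -> C) (l l' : C) :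
  cseries a l -> cseries a l' -> l = l'.
Proof. exact (filterlim_locally_unique _ l l'). Qed.

Lemma cseries_le (a : nat -> C) (b : nat -> R) (l : C) (s : R) :
  (forall k, Cmod (a k) <= b k) -> cseries a l -> is_series b s -> Cmod l <= s.
Proof.
  intros hab hl hs.
  assert (h1 : is_lim_seq (fun N => norm (sum_n (a : nat -> C_NormedModule) N))
                 (norm (l : C_NormedModule))).
  { eapply filterlim_comp; [exact hl|apply filterlim_norm]. }
  refine (is_lim_seq_le _ _ _ _ _ h1 (hs : is_lim_seq (sum_n b) s)).
  intros N; eapply Rle_trans; [apply (Cmod_csum a N)|].
  apply (sum_n_m_le _ _ 0 N), hab.
Qed.

(** This is [cseries_le] for the series started at [K + 1]. The factor [c] lets the tail of a
    weighted series control [c] times an unweighted tail. *)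
Lemma cseries_tail (a : nat -> C) (b : nat -> R) (l : C) (s c : R) (K : nat) :
  0 <= c -> (forall k, (K < k)%nat -> c * Cmod (a k) <= b k) ->
  cseries a l -> is_series b s ->
  c * Cmod (l - sum_n a K) <= s - sum_n b K.
Proof.
  intros hc hab hl hs.
  rewrite <- (Rabs_pos_eq c) at 1 by exact hc.
  rewrite <- Cmod_R, <- Cmod_mult.
  apply (cseries_le (fun k => (c * a (S K + k)%nat)%C)
           (fun k => b (S K + k)%nat)).
  - intros k; rewrite Cmod_mult, Cmod_R, Rabs_pos_eq by exact hc.
    apply hab; lia.
  - apply (is_series_scal (K := C_AbsRing) (V := C_NormedModule) (RtoC c)
             (fun k => a (S K + k)%nat)).
    apply is_series_incr_n; [lia|].
    replace (plus _ _) with l; [exact hl|].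
    change (l = ((l - sum_n a K) + sum_n a K)%C); cring.
  - apply is_series_incr_n; [lia|].
    replace (plus _ _) with s; [exact hs|].
    change (s = (s - sum_n b K) + sum_n b K); ring.
Qed.

Lemma series_tail_small (b : nat -> R) (s eps : R) : is_series b s -> 0 < eps ->
  exists K, s - sum_n b K < eps.
Proof.
  intros hs heps.
  destruct (proj1 (filterlim_locally _ _) hs (mkposreal eps heps)) as [N hN].
  exists N; specialize (hN N (le_n N)).
  change (Rabs (sum_n b N - s) < eps) in hN.
  apply Rabs_def2 in hN; lra.
Qed.

(* Fejer means of a function bounded by 1 on the circle and equal to 1 at 1:
   [sum (K + 1 - k) Re d_k <= K + 1] while [sum Re d_k = 1], so
   [sum k Re d_k >= 0] up to a tail. *)
Lemma re_weighted_coeff_sum_ge0 (d : nat -> C) (H : C -> C) (S0 : C) :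
  ex_series (fun k => INR (S k) * Cmod (d k)) ->
  (forall u, Cmod u = 1 -> cseries (fun k => (d k * u ^ k)%C) (H u)) ->
  (forall u, Cmod u = 1 -> Cmod (H u) <= 1) -> H 1 = 1 ->
  cseries (fun k => (INR k * d k)%C) S0 -> 0 <= Re S0.
Proof.
  intros [T hT] hser hle h1 hS.
  set (B := fun k => INR (S k) * Cmod (d k)) in *.
  apply Rnot_lt_le; intros hneg.
  (* Three errors of size [tau] add up below: from truncating [H] on the circle, from [1 - D] and
     from [S0 - Q]. Hence the division by 3. *)
  destruct (series_tail_small B T (- Re S0 / 3) hT) as [K hK]; [lra|].
  set (tau := T - sum_n B K) in *.
  assert (hK0 : 0 < INR (S K)) by (apply lt_0_INR; lia).
  assert (htail : forall u, Cmod u = 1 ->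
    INR (S K) * Cmod (H u - sum_n (fun k => d k * u ^ k)%C K) <= tau).
  { intros u hu; apply cseries_tail; [lra| |now apply hser|exact hT].
    intros k hk; rewrite Cmod_mult, Cmod_pow, hu, pow1, Rmult_1_r.
    apply Rmult_le_compat_r; [apply Cmod_ge_0|apply le_INR; lia]. }
  assert (hP : Cmod (sum_n (fun k => INR (S (K - k)) * d k)%C K)
               <= INR (S K) * (1 + tau / INR (S K))).
  { apply fejer_bound; intros u hu.
    set (P := sum_n _ K).
    replace (P : C) with (H u + - (H u - P))%C by cring.
    eapply Rle_trans; [apply Cmod_triangle|].
    apply Rplus_le_compat; [now apply hle|].
    rewrite Cmod_opp; apply Rle_div_r; [exact hK0|].
    rewrite Rmult_comm; now apply htail. }
  set (Q := sum_n (fun k => INR k * d k)%C K).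
  set (D := sum_n d K).
  (* Writing the weight as [K + 1] minus [k] separates the partial sum [D] of the values at [u = 1]
     from the partial sum [Q] of the series for [S0]. *)
  assert (hsplit : sum_n (fun k => INR (S (K - k)) * d k)%C K
                   = (INR (S K) * D - Q)%C).
  { unfold D, Q.
    transitivity (sum_n (fun k => INR (S K) * d k) K +
                  sum_n (fun k => - (1) * (INR k * d k)) K)%C.
    - etransitivity;
        [|exact (sum_n_plus (G := C_AbelianMonoid) _ _ K)].
      apply sum_n_ext_loc; intros k hk.
      change ((INR (S (K - k)) * d k)%C =
              (INR (S K) * d k + - (1) * (INR k * d k))%C).
      rewrite <- Nat.sub_succ_l, minus_INR, RtoC_minus by lia; cring.
    - rewrite !csum_mult_l; cring. }
  assert (hD : INR (S K) * Cmod (1 - D) <= tau).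
  { assert (h := htail 1 Cmod_1); rewrite h1 in h.
    rewrite (sum_n_ext _ d) in h; [exact h|].
    intros k; rewrite Cpow_1_l; cring. }
  assert (hQ : Cmod (S0 - Q) <= tau).
  { rewrite <- (Rmult_1_l (Cmod _)).
    apply cseries_tail; [lra| |exact hS|exact hT].
    intros k _; unfold B; rewrite Cmod_mult, Cmod_R, Rmult_1_l, S_INR.
    rewrite Rabs_pos_eq by apply pos_INR.
    assert (h := Cmod_ge_0 (d k)); nra. }
  rewrite hsplit in hP.
  assert (hP' := Rle_trans _ _ _ (Rle_abs _)
                   (Rle_trans _ _ _ (re_le_Cmod _) hP)).
  assert (hD' := Rle_trans _ _ _ (Rle_abs _) (re_le_Cmod (1 - D))).
  assert (hQ' := Rle_trans _ _ _ (Rle_abs _)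
    (Rle_trans _ _ _ (re_le_Cmod (- (S0 - Q)))
      (Rle_trans _ _ _ (Req_le _ _ (Cmod_opp _)) hQ))).
  replace (INR (S K) * (1 + tau / INR (S K))) with (INR (S K) + tau) in hP'
    by (field; lra).
  unfold Cminus in *.
  rewrite ?re_plus, ?re_opp, ?re_plus, ?re_scal_l, ?re_opp, ?re_RtoC in *.
  assert (INR (S K) * (1 + - Re D) <= tau) by nra.
  lra.
Qed.

(** * Complex derivatives and power series *)

Notation is_Cderive := (is_derive (K := C_AbsRing) (V := C_NormedModule)).

(** The domain of [is_derive] carries the [Cmod] balls; [locally_C] exchanges them for the product
    neighbourhoods of [C_UniformSpace]. *)
Lemma is_Cderive_eps (f : C -> C) (z l : C) :
  is_Cderive f z l <->
  forall eps : posreal, locally (T := C_UniformSpace) z (fun w =>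
    Cmod (f w - f z - (w - z) * l) <= eps * Cmod (w - z)).
Proof.
  split.
  - intros [_ h] eps.
    apply locally_C; exact (h z (fun P hP => hP) eps).
  - intros h; split; [apply is_linear_scal_l|].
    intros x hx eps.
    apply (is_filter_lim_locally_unique (K := C_AbsRing)
      (V := AbsRing_NormedModule C_AbsRing)) in hx; rewrite <- hx.
    apply locally_C, h.
Qed.

(** The product rule is stated for a ring seen as a module over itself. Both module structures on
    [C] yield the same differential condition, so it can be passed back and forth. *)
Lemma is_Cderive_of_absring (f : C -> C) (z l : C) :
  is_derive (K := C_AbsRing) (V := AbsRing_NormedModule C_AbsRing) f z l ->
  is_Cderive f z l.
Proof.
  intros [_ h]; split; [apply is_linear_scal_l|exact h].
Qed.

Lemma is_Cderive_to_absring (f : C -> C) (z l : C) :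
  is_Cderive f z l ->
  is_derive (K := C_AbsRing) (V := AbsRing_NormedModule C_AbsRing) f z l.
Proof.
  intros [_ h]; split; [apply is_linear_scal_l|exact h].
Qed.

Lemma is_Cderive_mult (f g : C -> C) (z df dg : C) :
  is_Cderive f z df -> is_Cderive g z dg ->
  is_Cderive (fun w => (f w * g w)%C) z (df * g z + f z * dg)%C.
Proof.
  intros hf hg; apply is_Cderive_of_absring.
  apply (is_derive_mult (K := C_AbsRing) f g z df dg);
    [now apply is_Cderive_to_absring | now apply is_Cderive_to_absring |].
  exact Cmult_comm.
Qed.

Lemma is_Cderive_plus (f g : C -> C) (z df dg : C) :
  is_Cderive f z df -> is_Cderive g z dg ->
  is_Cderive (fun w => (f w + g w)%C) z (df + dg)%C.
Proof.
  exact (is_derive_plus (K := C_AbsRing) (V := C_NormedModule) f g z df dg).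
Qed.

Lemma is_Cderive_const (c z : C) : is_Cderive (fun _ => c) z (RtoC 0).
Proof. exact (is_derive_const (K := C_AbsRing) (V := C_NormedModule) c z). Qed.

Lemma is_Cderive_id (z : C) : is_Cderive (fun w => w) z (RtoC 1).
Proof. apply is_Cderive_of_absring, (is_derive_id (K := C_AbsRing)). Qed.

Lemma is_Cderive_pow (n : nat) (z : C) :
  is_Cderive (fun w => (w ^ n)%C) z (INR n * z ^ pred n)%C.
Proof.
  induction n as [|n IH].
  - replace (INR 0 * z ^ pred 0)%C with (RtoC 0) by (simpl; cring).
    exact (is_Cderive_const 1 z).
  - replace (INR (S n) * z ^ pred (S n))%C
      with (1 * z ^ n + z * (INR n * z ^ pred n))%C.
    + apply (is_Cderive_mult (fun w => w) (fun w => w ^ n)%C);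
        [apply is_Cderive_id|exact IH].
    + rewrite S_INR, RtoC_plus; destruct n; simpl; cring.
Qed.

Lemma is_Cderive_cont (f : C -> C) (z l : C) : is_Cderive f z l ->
  filterlim f (locally (T := C_UniformSpace) z) (locally (f z)).
Proof.
  intros h P hP.
  assert (hc : continuous (T := AbsRing_UniformSpace C_AbsRing)
                          (U := C_UniformSpace) f z).
  { exact (ex_derive_continuous (K := C_AbsRing) (V := C_NormedModule) f z
             (ex_intro _ l h)). }
  apply locally_C; exact (hc P hP).
Qed.

(** * Power series converging absolutely on the open disk, and their derivatives *)

Definition conv_disk (c : nat -> C) : Prop :=
  forall r, 0 <= r < 1 -> ex_series (fun k => Cmod (c k) * r ^ k).

(* Junk value where the series diverges. *)
Definition cps (c : nat -> C) (z : C) : C :=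
  iota (T := C_CompleteNormedModule) (fun l => cseries (fun k => c k * z ^ k)%C l).

Lemma cps_correct (c : nat -> C) (z : C) : conv_disk c -> Cmod z < 1 ->
  cseries (fun k => c k * z ^ k)%C (cps c z).
Proof.
  intros hc hz.
  destruct (ex_series_le (K := C_AbsRing) (V := C_CompleteNormedModule)
    (fun k => c k * z ^ k)%C (fun k => Cmod (c k) * Cmod z ^ k)) as [l hl].
  - intros k; right; change (Cmod (c k * z ^ k) = Cmod (c k) * Cmod z ^ k).
    now rewrite Cmod_mult, Cmod_pow.
  - apply hc; split; [apply Cmod_ge_0|exact hz].
  - apply (iota_correct (K := C_AbsRing) (V := C_CompleteNormedModule)
      (fun l : C => cseries (fun k => c k * z ^ k)%C l)).
    exists l; split; [exact hl|].
    intros l' hl'; exact (cseries_unique _ _ _ hl hl').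
Qed.

(** Together with [conv_disk_radius], this makes the real theory of [CV_radius] available for the
    moduli of the coefficients. *)
Lemma conv_disk_of_radius (c : nat -> C) :
  Rbar_le 1 (CV_radius (fun k => Cmod (c k))) -> conv_disk c.
Proof.
  intros h r hr.
  apply ex_series_Rabs, CV_disk_inside; rewrite Rabs_pos_eq by apply hr.
  eapply Rbar_lt_le_trans; [|exact h]; simpl; apply hr.
Qed.

Lemma series_term_bounded (a : nat -> R) : ex_series a ->
  exists M, forall k, Rabs (a k) <= M.
Proof.
  intros h; apply ex_series_lim_0, is_lim_seq_Reals in h.
  destruct (maj_by_pos a) as [M [_ hM]]; [now exists 0|now exists M].
Qed.

(** Bounded terms at [r] put [r] below the radius. A radius [R0 < 1] would be exceeded by the
    midpoint of [R0] and 1. *)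
Lemma CV_radius_ge_1 (a : nat -> R) :
  (forall r, 0 <= r < 1 -> exists M, forall k, Rabs (a k * r ^ k) <= M) ->
  Rbar_le 1 (CV_radius a).
Proof.
  intros ha.
  destruct (CV_radius_bounded a) as [hub _].
  assert (h0 := CV_radius_ge_0 a).
  assert (h : forall r, 0 <= r < 1 -> Rbar_le r (CV_radius a)).
  { intros r hr; now apply hub, ha. }
  destruct (CV_radius a) as [R0| |]; simpl in *; try easy.
  apply Rnot_lt_le; intros hlt.
  specialize (h ((R0 + 1) / 2)); lra.
Qed.

Lemma conv_disk_radius (c : nat -> C) :
  conv_disk c -> Rbar_le 1 (CV_radius (fun k => Cmod (c k))).
Proof.
  intros h; apply CV_radius_ge_1; intros r hr.
  exact (series_term_bounded _ (h r hr)).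
Qed.

Lemma conv_disk_le (c d : nat -> C) (M : R) :
  (forall k, Cmod (d k) <= M * Cmod (c k)) -> conv_disk c -> conv_disk d.
Proof.
  intros hd hc r hr.
  apply (ex_series_le (K := R_AbsRing) (V := R_CompleteNormedModule) _
           (fun k => M * (Cmod (c k) * r ^ k))).
  - intros k; assert (hk := pow_le r k (proj1 hr)).
    change (Rabs (Cmod (d k) * r ^ k) <= M * (Cmod (c k) * r ^ k)).
    rewrite Rabs_pos_eq by (apply Rmult_le_pos; [apply Cmod_ge_0|exact hk]).
    rewrite <- Rmult_assoc; now apply Rmult_le_compat_r.
  - apply (ex_series_scal (K := R_AbsRing) (V := R_NormedModule) M), hc, hr.
Qed.

(** The weights [k + 1] arise by differentiating [x] times the series of moduli, and neither
    operation changes the radius of convergence. *)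
Lemma conv_disk_INR (c : nat -> C) :
  conv_disk c -> conv_disk (fun k => INR (S k) * c k)%C.
Proof.
  intros hc; apply conv_disk_of_radius.
  rewrite (CV_radius_ext _
    (PS_derive (PS_incr_1 (V := R_NormedModule) (fun k => Cmod (c k))))).
  - rewrite CV_radius_derive, CV_radius_incr_1; now apply conv_disk_radius.
  - intros k; rewrite Cmod_mult, Cmod_R, Rabs_pos_eq by apply pos_INR.
    reflexivity.
Qed.

Lemma conv_disk_shift (c : nat -> C) :
  conv_disk c -> conv_disk (fun k => c (S k)).
Proof.
  intros hc; apply conv_disk_of_radius.
  change (fun k => Cmod (c (S k)))
    with (PS_decr_1 (V := R_NormedModule) (fun k => Cmod (c k))).
  rewrite CV_radius_decr_1.
  now apply conv_disk_radius.
Qed.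

Definition cps_derive (c : nat -> C) (k : nat) : C := (INR (S k) * c (S k))%C.

Lemma conv_disk_derive (c : nat -> C) : conv_disk c -> conv_disk (cps_derive c).
Proof.
  intros hc.
  (* Shifting the weighted sequence produces the weight [k + 2], which dominates the required
     [k + 1]. *)
  apply (conv_disk_le (fun k => INR (S (S k)) * c (S k))%C _ 1).
  - intros k; unfold cps_derive.
    rewrite !Cmod_mult, !Cmod_R, !Rabs_pos_eq, Rmult_1_l by apply pos_INR.
    apply Rmult_le_compat_r; [apply Cmod_ge_0|apply le_INR; lia].
  - exact (conv_disk_shift _ (conv_disk_INR c hc)).
Qed.

(** The term [k = 0] vanishes through [INR 0], so prepending it is harmless; in this indexing the
    derivative matches [cps c] term by term. *)
Lemma cps_derive_series (c : nat -> C) (z : C) : conv_disk c -> Cmod z < 1 ->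
  cseries (fun k => INR k * c k * z ^ pred k)%C (cps (cps_derive c) z).
Proof.
  intros hc hz.
  apply is_series_decr_1.
  replace (plus _ _) with (cps (cps_derive c) z).
  - exact (cps_correct _ z (conv_disk_derive c hc) hz).
  - change (cps (cps_derive c) z = cps (cps_derive c) z
       + - (INR 0 * c 0%nat * z ^ 0))%C; simpl INR; cring.
Qed.

(** Induction on [k]: the next remainder is [w] times the current one plus k z^(k-1) (w - z)^2, and
    k^2 + k <= (k + 1)^2. The factor [r ^ 2] on the left avoids the exponent k - 2. *)
Lemma cpow_taylor2 (r : R) (z w : C) (k : nat) : Cmod z <= r -> Cmod w <= r ->
  r ^ 2 * Cmod (w ^ k - z ^ k - (w - z) * (INR k * z ^ pred k)) <=
  INR k ^ 2 * r ^ k * Cmod (w - z) ^ 2.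
Proof.
  intros hz hw.
  assert (hr : 0 <= r) by (eapply Rle_trans; [apply (Cmod_ge_0 z)|exact hz]).
  induction k as [|k IH].
  - replace (w ^ 0 - z ^ 0 - (w - z) * (INR 0 * z ^ pred 0))%C with (RtoC 0)
      by (simpl; cring).
    rewrite Cmod_0; simpl; lra.
  - set (E := (w ^ k - z ^ k - (w - z) * (INR k * z ^ pred k))%C) in *.
    replace (w ^ S k - z ^ S k - (w - z) * (INR (S k) * z ^ pred (S k)))%C
      with (w * E + (w - z) * (w - z) * (INR k * z ^ pred k))%C.
    2: { unfold E; rewrite !Cpow_S, S_INR, RtoC_plus; destruct k; simpl; cring. }
    set (e := Cmod (w - z)) in *.
    assert (he : 0 <= e) by apply Cmod_ge_0.
    assert (hp : INR k * Cmod z ^ pred k * r <= INR k * r ^ k).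
    { destruct k as [|k]; [simpl; lra|]; cbn [pred].
      rewrite Rmult_assoc; apply Rmult_le_compat_l; [apply pos_INR|].
      rewrite (Rmult_comm _ r); cbn [pow]; apply Rmult_le_compat_l; [exact hr|].
      apply pow_incr; split; [apply Cmod_ge_0|exact hz]. }
    eapply Rle_trans;
      [apply Rmult_le_compat_l; [apply pow2_ge_0|apply Cmod_triangle]|].
    rewrite !Cmod_mult, Cmod_R, Cmod_pow, Rabs_pos_eq by apply pos_INR.
    fold e.
    assert (hk := pos_INR k); assert (hrk := pow_le r k hr).
    rewrite S_INR.
    apply Rle_trans with
      (r * (INR k ^ 2 * r ^ k * e ^ 2) + e ^ 2 * r * (INR k * r ^ k)).
    + rewrite Rmult_plus_distr_l; apply Rplus_le_compat.
      * apply Rle_trans with (Cmod w * (r ^ 2 * Cmod E)); [right; ring|].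
        apply Rmult_le_compat; try exact hw; try exact IH.
        -- apply Cmod_ge_0.
        -- apply Rmult_le_pos; [apply pow2_ge_0|apply Cmod_ge_0].
      * apply Rle_trans with (e ^ 2 * r * (INR k * Cmod z ^ pred k * r));
          [right; ring|].
        apply Rmult_le_compat_l; [|exact hp].
        apply Rmult_le_pos; [apply pow2_ge_0|exact hr].
    + assert (0 <= r * r ^ k * e ^ 2 * (INR k + 1)).
      { repeat apply Rmult_le_pos; try lra; apply pow2_ge_0. }
      simpl; simpl in H; nra.
Qed.

Lemma Cmod_lt_locally (z : C) (r : R) : Cmod z < r ->
  locally (T := C_UniformSpace) z (fun w => Cmod w < r).
Proof.
  intros h.
  apply locally_C.
  exists (mkposreal (r - Cmod z) (proj2 (Rlt_0_minus _ _) h)).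
  intros w hw; change (Cmod (w - z) < r - Cmod z) in hw.
  replace w with ((w - z) + z)%C by cring.
  eapply Rle_lt_trans; [apply Cmod_triangle|lra].
Qed.

(** Summing the second-order bounds of [cpow_taylor2] over all terms gives a remainder quadratic in
    [w - z]. *)
Lemma is_Cderive_cps (c : nat -> C) (z : C) : conv_disk c -> Cmod z < 1 ->
  is_Cderive (cps c) z (cps (cps_derive c) z).
Proof.
  intros hc hz.
  (* A radius strictly between |z| and 1 dominates [z] and all nearby [w]. *)
  set (r := (Cmod z + 1) / 2).
  assert (hz0 := Cmod_ge_0 z).
  assert (hr : 0 < r < 1) by (unfold r; lra).
  assert (hr2 : 0 < r ^ 2) by (apply pow_lt; lra).
  (* Two applications give the weight (k + 1)^2, which absorbs the [INR k ^ 2] of [cpow_taylor2]. *)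
  destruct (conv_disk_INR _ (conv_disk_INR c hc) r ltac:(lra)) as [M hM].
  apply is_Cderive_eps; intros eps.
  assert (hd : 0 < eps * r ^ 2 / (Rabs M + 1)).
  { apply Rdiv_lt_0_compat; [apply Rmult_lt_0_compat; [apply cond_pos|exact hr2]|].
    assert (h := Rabs_pos M); lra. }
  assert (hlt := Cmod_lt_locally z r ltac:(unfold r; lra)).
  assert (hnear : locally (T := C_UniformSpace) z (fun w =>
            Cmod (w - z) < eps * r ^ 2 / (Rabs M + 1))).
  { apply locally_C; exists (mkposreal _ hd); intros w hw; exact hw. }
  generalize (filter_and _ _ hnear hlt); apply filter_imp; intros w [hwz hw].
  set (E := (cps c w - cps c z - (w - z) * cps (cps_derive c) z)%C).
  set (e := Cmod (w - z)) in *.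
  assert (he : 0 <= e) by apply Cmod_ge_0.
  assert (hE : r ^ 2 * Cmod E <= e ^ 2 * M).
  { rewrite <- (Rabs_pos_eq (r ^ 2)) by lra.
    rewrite <- Cmod_R, <- Cmod_mult.
    apply (cseries_le (fun k => RtoC (r ^ 2) *
       (c k * w ^ k - c k * z ^ k - (w - z) * (INR k * c k * z ^ pred k)))%C
       (fun k => e ^ 2 * (Cmod (INR (S k) * (INR (S k) * c k)) * r ^ k))).
    - intros k.
      replace (RtoC (r ^ 2) *
         (c k * w ^ k - c k * z ^ k - (w - z) * (INR k * c k * z ^ pred k)))%C
        with (c k * (RtoC (r ^ 2) *
           (w ^ k - z ^ k - (w - z) * (INR k * z ^ pred k))))%C by cring.
      rewrite !Cmod_mult, !Cmod_R, !(Rabs_pos_eq (INR _)) by apply pos_INR.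
      rewrite (Rabs_pos_eq (r ^ 2)) by lra.
      assert (h := cpow_taylor2 r z w k ltac:(unfold r; lra) ltac:(lra)).
      fold e in h.
      assert (hk := pos_INR k); assert (hrk := pow_le r k ltac:(lra)).
      assert (hck := Cmod_ge_0 (c k)); assert (he2 := pow2_ge_0 e).
      rewrite S_INR.
      apply Rle_trans with (Cmod (c k) * (INR k ^ 2 * r ^ k * e ^ 2)).
      + apply Rmult_le_compat_l; assumption.
      + assert (0 <= Cmod (c k) * r ^ k * e ^ 2 * (2 * INR k + 1)).
        { repeat apply Rmult_le_pos; lra. }
        nra.
    - apply (is_series_scal (K := C_AbsRing) (V := C_NormedModule) (RtoC (r ^ 2))
        (fun k => c k * w ^ k - c k * z ^ k
                  - (w - z) * (INR k * c k * z ^ pred k))%C).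
      apply (is_series_minus (K := C_AbsRing) (V := C_NormedModule)
        (fun k => c k * w ^ k - c k * z ^ k)%C).
      + apply (is_series_minus (K := C_AbsRing) (V := C_NormedModule));
          apply cps_correct; trivial; lra.
      + apply (is_series_scal (K := C_AbsRing) (V := C_NormedModule) (w - z)%C
          (fun k => INR k * c k * z ^ pred k)%C).
        now apply cps_derive_series.
    - exact (is_series_scal (K := R_AbsRing) (V := R_NormedModule) (e ^ 2) _ _ hM). }
  apply Rmult_le_reg_l with (r ^ 2); [exact hr2|].
  eapply Rle_trans; [exact hE|].
  assert (hM1 := Rle_abs M).
  assert (h : e * (Rabs M + 1) <= eps * r ^ 2).
  { apply Rle_div_r; [assert (h := Rabs_pos M); lra|lra]. }
  nra.
Qed.

(** Pulling back along [cis] reduces this to the extreme value theorem on the interval from [- PI]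
    to [PI]. *)
Lemma circle_max (F : C -> R) :
  (forall u, Cmod u = 1 ->
     filterlim F (locally (T := C_UniformSpace) u) (locally (F u))) ->
  exists u0, Cmod u0 = 1 /\ forall u, Cmod u = 1 -> F u <= F u0.
Proof.
  intros hF.
  destruct (continuity_ab_maj (fun t => F (cis t)) (- PI) PI) as [t [ht _]].
  - assert (h := PI_RGT_0); lra.
  - intros t _; apply continuity_pt_filterlim.
    apply (filterlim_comp _ _ _ cis F _ (locally (T := C_UniformSpace) (cis t)));
      [|apply hF, Cmod_cis].
    intros P [eps hP].
    assert (hc : locally t (fun s => Rabs (cos s - cos t) < eps)).
    { apply (proj1 (continuity_pt_locally cos t)), continuity_cos. }
    assert (hs : locally t (fun s => Rabs (sin s - sin t) < eps)).
    { apply (proj1 (continuity_pt_locally sin t)), continuity_sin. }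
    change (locally t (fun s => P (cis s))).
    generalize (filter_and _ _ hc hs); apply filter_imp; intros s [h1 h2].
    apply hP; split; assumption.
  - exists (cis t); split; [apply Cmod_cis|].
    intros u hu; destruct (unit_circle_cis u hu) as [s [hs ->]].
    now apply ht.
Qed.

(** * Jack's lemma *)

(* Points [u = (1 + i s) / (1 - i s)] near 1: to first order in [s],
   [Re ((u - 1) q) = - 2 s Im q]. *)
Lemma circle_increase (q : C) (delta : R) : Im q <> 0 -> 0 < delta ->
  exists u, Cmod u = 1 /\ Cmod (u - 1) < delta /\
    Rabs (Im q) / 4 * Cmod (u - 1) < Re ((u - 1) * q).
Proof.
  intros hq hdelta.
  set (Q := Rabs (Im q)).
  assert (hQ : 0 < Q) by now apply Rabs_pos_lt.
  set (P := Rabs (Re q)).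
  assert (hP : 0 <= P) by apply Rabs_pos.
  assert (hx : 0 < Q / (4 * (P + 1))) by (apply Rdiv_lt_0_compat; lra).
  (* The bound by [delta / 4] keeps [u] within [delta] of 1; the last bound keeps the second-order
     term in [Re q] below the gain from [Im q]. *)
  assert (hs : exists s, 0 < s /\ s <= 1 /\ s <= delta / 4 /\ 4 * s * P <= Q).
  { exists (Rmin (Rmin 1 (delta / 4)) (Q / (4 * (P + 1)))).
    set (s := Rmin _ _).
    assert (h1 : s <= Rmin 1 (delta / 4)) by apply Rmin_l.
    assert (h2 : s <= Q / (4 * (P + 1))) by apply Rmin_r.
    assert (h3 := Rmin_l 1 (delta / 4)); assert (h4 := Rmin_r 1 (delta / 4)).
    assert (h0 : 0 < s) by (repeat apply Rmin_glb_lt; lra).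
    apply Rle_div_r in h2; [|lra].
    repeat split; nra. }
  destruct hs as [s [hs0 [hs1 [hs2 hs3]]]].
  (* The direction along the circle is opposite to the sign of [Im q], so that the first-order
     change is an increase. *)
  set (t := if Rle_dec 0 (Im q) then - s else s).
  assert (ht2 : t ^ 2 = s ^ 2)
    by (unfold t; destruct (Rle_dec 0 (Im q)); ring).
  assert (htq : t * Im q = - (s * Q)).
  { unfold t, Q; destruct (Rle_dec 0 (Im q));
      [rewrite Rabs_pos_eq by lra|rewrite Rabs_left by lra]; ring. }
  assert (hd : 0 < 1 + s ^ 2) by nra.
  set (u := ((1 - s ^ 2) / (1 + s ^ 2), 2 * t / (1 + s ^ 2)) : C).
  assert (hu1 : (u - 1)%C = (- (2 * s ^ 2 / (1 + s ^ 2)), 2 * t / (1 + s ^ 2))).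
  { unfold u, Cminus, Cplus, Copp, RtoC; simpl; f_equal; field; simpl in hd; lra. }
  assert (hle : Cmod (u - 1) <= 2 * s).
  { apply Rsqr_incr_0; [|apply Cmod_ge_0|lra].
    rewrite !Rsqr_pow2, Cmod2_alt, hu1; unfold Re, Im; cbn [fst snd].
    apply Rle_trans with (4 * s ^ 2 / (1 + s ^ 2)).
    - right; replace ((2 * t / (1 + s ^ 2)) ^ 2)
        with (4 * t ^ 2 / (1 + s ^ 2) ^ 2) by (field; lra).
      rewrite ht2; field; lra.
    - apply Rle_div_l; [lra|nra]. }
  exists u; repeat split.
  - apply Rsqr_inj; [apply Cmod_ge_0|lra|].
    rewrite !Rsqr_pow2, Cmod2_alt; unfold u, Re, Im; cbn [fst snd].
    replace ((2 * t / (1 + s ^ 2)) ^ 2)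
        with (4 * t ^ 2 / (1 + s ^ 2) ^ 2) by (field; lra).
    rewrite ht2; field; lra.
  - lra.
  - assert (hu2 : Re (u - 1) = - (2 * s ^ 2 / (1 + s ^ 2))) by now rewrite hu1.
    assert (hu3 : Im (u - 1) = 2 * t / (1 + s ^ 2)) by now rewrite hu1.
    rewrite re_mult, hu2, hu3.
    assert (hr : Rabs (Re q) = P) by reflexivity.
    assert (hre := Rle_abs (Re q)); rewrite hr in hre.
    replace (- (2 * s ^ 2 / (1 + s ^ 2)) * Re q - 2 * t / (1 + s ^ 2) * Im q)
      with ((- 2 * s ^ 2 * Re q - 2 * (t * Im q)) / (1 + s ^ 2)) by (field; lra).
    rewrite htq.
    apply Rle_lt_trans with (Q / 4 * (2 * s)).
    + apply Rmult_le_compat_l; lra.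
    + apply (proj1 (Rlt_div_r _ _ (1 + s ^ 2) ltac:(lra))).
      assert (s * (s * Re q) <= s * (Q / 4)).
      { apply Rmult_le_compat_l; nra. }
      assert (s ^ 2 <= 1) by nra.
      assert (h0 : 0 < s * Q) by (apply Rmult_lt_0_compat; lra).
      assert (s * Q * s ^ 2 <= s * Q * 1) by (apply Rmult_le_compat_l; lra).
      lra.
Qed.

(** To first order [h (z0 * u) / h z0] is [1 + (u - 1) * q]. If [Im q] were nonzero,
    [circle_increase] would give a [u] at which its real part exceeds 1, against maximality. *)
Lemma log_derive_im_eq0 (h : C -> C) (z0 dh : C) :
  h z0 <> 0 -> is_Cderive h z0 dh ->
  (forall u, Cmod u = 1 -> Cmod (h (z0 * u)) <= Cmod (h z0))%C ->
  Im (z0 * dh / h z0) = 0.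
Proof.
  intros h0 hder hmax.
  set (q := (z0 * dh / h z0)%C).
  destruct (Req_dec (Im q) 0) as [hq|hq]; [exact hq|exfalso].
  assert (hH : 0 < Cmod (h z0)) by now apply Cmod_gt_0.
  assert (hz := Cmod_ge_0 z0).
  assert (hQ : 0 < Rabs (Im q)) by now apply Rabs_pos_lt.
  (* With this tolerance the error, divided by [h z0], is at most the margin
     [Rabs (Im q) / 4 * Cmod (u - 1)] of [circle_increase]. The [+ 1] keeps the denominator
     positive. *)
  assert (he : 0 < Rabs (Im q) / 4 * Cmod (h z0) / (Cmod z0 + 1)).
  { apply Rdiv_lt_0_compat; [nra|lra]. }
  assert (hl := proj1 (is_Cderive_eps h z0 dh) hder (mkposreal _ he)).
  apply locally_C in hl; destruct hl as [[d hd] hl]; simpl in hl.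
  destruct (circle_increase q (d / (Cmod z0 + 1))) as [u [hu [hud hui]]];
    [exact hq|apply Rdiv_lt_0_compat; lra|].
  assert (hu0 := Cmod_ge_0 (u - 1)).
  assert (hw : (z0 * u - z0)%C = (z0 * (u - 1))%C) by cring.
  specialize (hl (z0 * u)%C).
  apply Rlt_div_r in hud; [|lra].
  assert (hE : Cmod (h (z0 * u) - h z0 - (z0 * u - z0) * dh)%C
               <= Rabs (Im q) / 4 * Cmod (h z0) * Cmod (u - 1)).
  { eapply Rle_trans; [apply hl|].
    - change (Cmod (z0 * u - z0) < d); rewrite hw, Cmod_mult; nra.
    - rewrite hw, Cmod_mult.
      set (k := Rabs (Im q) / 4 * Cmod (h z0)).
      assert (hk : 0 <= k) by (unfold k; nra).
      apply Rle_trans with (k * Cmod (u - 1) * (Cmod z0 / (Cmod z0 + 1))).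
      + right; unfold k; simpl; field; lra.
      + rewrite <- (Rmult_1_r (k * Cmod (u - 1))) at 2.
        apply Rmult_le_compat_l; [nra|].
        apply Rle_div_l; lra. }
  set (E := (h (z0 * u) - h z0 - (z0 * u - z0) * dh)%C) in *.
  assert (hEq : (E / h z0)%C = (h (z0 * u) / h z0 - 1 - (u - 1) * q)%C).
  { unfold E, q; rewrite hw; field; exact h0. }
  assert (hE1 : Cmod (E / h z0) <= Rabs (Im q) / 4 * Cmod (u - 1)).
  { rewrite Cmod_div by exact h0.
    apply Rle_div_l; [exact hH|]; lra. }
  assert (hm : Cmod (h (z0 * u) / h z0)%C <= 1).
  { rewrite Cmod_div by exact h0.
    apply Rle_div_l; [exact hH|]; rewrite Rmult_1_l; now apply hmax. }
  assert (h2 := Rle_trans _ _ _ (Rle_abs _) (Rle_trans _ _ _ (re_le_Cmod _) hm)).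
  assert (h3 := Rle_trans _ _ _ (Rle_abs _)
    (Rle_trans _ _ _ (re_le_Cmod (- (E / h z0)))
      (Rle_trans _ _ _ (Req_le _ _ (Cmod_opp _)) hE1))).
  rewrite hEq in h3; unfold Cminus in h3 at 1 2.
  rewrite re_opp, !re_plus, !re_opp, re_RtoC in h3.
  lra.
Qed.

(** The normalised function [cps c (z0 * u) / cps c z0] of [u] is bounded by 1 on the circle and
    equals 1 at 1. Its coefficients weighted by [k] sum to the quotient in question, so
    [re_weighted_coeff_sum_ge0] applies. *)
Lemma log_derive_re_ge0 (c : nat -> C) (z0 : C) :
  conv_disk c -> Cmod z0 < 1 -> cps c z0 <> 0 ->
  (forall u, Cmod u = 1 -> Cmod (cps c (z0 * u)) <= Cmod (cps c z0))%C ->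
  0 <= Re (z0 * cps (cps_derive c) z0 / cps c z0).
Proof.
  intros hc hz h0 hmax.
  set (h := cps c z0) in *.
  assert (hH : 0 < Cmod h) by now apply Cmod_gt_0.
  apply (re_weighted_coeff_sum_ge0 (fun k => c k * z0 ^ k / h)%C
           (fun u => cps c (z0 * u) / h)%C).
  - apply (ex_series_ext (fun k => / Cmod h *
       (Cmod (INR (S k) * c k) * Cmod z0 ^ k))).
    + intros k; rewrite Cmod_div by exact h0.
      rewrite !Cmod_mult, Cmod_pow, Cmod_R, Rabs_pos_eq by apply pos_INR.
      change (/ Cmod h * (INR (S k) * Cmod (c k) * Cmod z0 ^ k) =
        INR (S k) * (Cmod (c k) * Cmod z0 ^ k / Cmod h)); field; lra.
    + apply (ex_series_scal (K := R_AbsRing) (V := R_NormedModule) (/ Cmod h)).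
      apply conv_disk_INR; [exact hc|split; [apply Cmod_ge_0|exact hz]].
  - intros u hu.
    assert (hzu : Cmod (z0 * u) < 1) by (rewrite Cmod_mult, hu; lra).
    apply (is_series_ext (K := C_AbsRing) (V := C_NormedModule)
      (fun k => / h * (c k * (z0 * u) ^ k))%C).
    + intros k; rewrite Cpow_mult_l; unfold Cdiv; cring.
    + replace (cps c (z0 * u) / h)%C with (/ h * cps c (z0 * u))%C
        by (unfold Cdiv; cring).
      apply (is_series_scal (K := C_AbsRing) (V := C_NormedModule) (/ h)%C).
      now apply cps_correct.
  - intros u hu; rewrite Cmod_div by exact h0.
    apply Rle_div_l; [exact hH|]; rewrite Rmult_1_l; now apply hmax.
  - rewrite Cmult_1_r; fold h; field; exact h0.
  - apply (is_series_ext (K := C_AbsRing) (V := C_NormedModule)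
      (fun k => z0 / h * (INR k * c k * z0 ^ pred k))%C).
    + intros k; unfold Cdiv; destruct k; simpl; cring.
    + replace (z0 * cps (cps_derive c) z0 / h)%C
        with (z0 / h * cps (cps_derive c) z0)%C by (unfold Cdiv; cring).
      apply (is_series_scal (K := C_AbsRing) (V := C_NormedModule) (z0 / h)%C).
      now apply cps_derive_series.
Qed.

(* Jack's lemma: for [W z = z ^ n * cps c z] the conclusion reads
   [z0 * W' z0 = (n + m) * W z0]. *)
Lemma jack (c : nat -> C) (z1 : C) :
  conv_disk c -> Cmod z1 < 1 -> z1 <> 0 -> cps c z1 <> 0 ->
  exists z0 m, Cmod z0 = Cmod z1 /\ Cmod (cps c z1) <= Cmod (cps c z0) /\
    0 <= m /\ (z0 * cps (cps_derive c) z0 = RtoC m * cps c z0)%C.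
Proof.
  intros hc hz hz0 h1.
  assert (hr : 0 < Cmod z1) by now apply Cmod_gt_0.
  set (r := Cmod z1) in *.
  assert (hmod : forall u, Cmod u = 1 -> Cmod (RtoC r * u) = r).
  { intros u hu; rewrite Cmod_mult, Cmod_R, hu, Rabs_pos_eq; lra. }
  destruct (circle_max (fun u => Cmod (cps c (RtoC r * u)))) as [u0 [hu0 hmax]].
  - intros u hu.
    apply (filterlim_comp _ _ _ (fun u => cps c (RtoC r * u)) Cmod _
             (locally (T := C_UniformSpace) (cps c (RtoC r * u)))).
    + apply (filterlim_comp _ _ _ (fun u => RtoC r * u)%C (cps c) _
             (locally (T := C_UniformSpace) (RtoC r * u)%C)).
      * apply (is_Cderive_cont _ u (0 * u + r * 1)%C).
        apply (is_Cderive_mult (fun _ => RtoC r) (fun u => u));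
          [apply is_Cderive_const|apply is_Cderive_id].
      * apply (is_Cderive_cont _ _ (cps (cps_derive c) (RtoC r * u))).
        apply is_Cderive_cps; [exact hc|rewrite hmod; assumption].
    + exact (filterlim_norm (V := C_NormedModule) (cps c (RtoC r * u)%C)).
  - set (z0 := (RtoC r * u0)%C) in *.
    assert (hz0r : Cmod z0 = r) by now apply hmod.
    assert (hle : Cmod (cps c z1) <= Cmod (cps c z0)).
    { assert (hrn : RtoC r <> 0) by (intros h; apply RtoC_inj in h; lra).
      replace z1 with (RtoC r * (z1 / RtoC r))%C by (field; exact hrn).
      apply hmax; rewrite Cmod_div, Cmod_R, Rabs_pos_eq by (assumption || lra).
      fold r; field; lra. }
    assert (h0 : cps c z0 <> 0).
    { apply Cmod_gt_0 in h1; apply Cmod_gt_0; lra. }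
    (* Rotating [z0] stays on the same circle, so maximality can be expressed relative to [z0]. *)
    assert (hmax0 : forall u, Cmod u = 1 ->
              Cmod (cps c (z0 * u)) <= Cmod (cps c z0)).
    { intros u hu; unfold z0; rewrite <- Cmult_assoc.
      apply hmax; rewrite Cmod_mult, hu0, hu; ring. }
    set (q := (z0 * cps (cps_derive c) z0 / cps c z0)%C).
    assert (him : Im q = 0).
    { apply log_derive_im_eq0; trivial; apply is_Cderive_cps; trivial; lra. }
    assert (hre : 0 <= Re q) by (apply log_derive_re_ge0; trivial; lra).
    exists z0, (Re q); repeat split; trivial.
    replace (RtoC (Re q)) with q.
    + unfold q; field; exact h0.
    + unfold RtoC; rewrite <- him; apply surjective_pairing.
Qed.

(* [Re (b w / (1 + b w)) >= b / (1 + b)] for [|w| = 1 <= b]. *)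
Lemma re_ratio_bound (W q : C) (k n b : R) :
  1 <= b -> b <= Cmod W -> 0 < n <= k -> (RtoC k * W = q * (1 + W))%C ->
  n * b / (1 + b) <= Re q.
Proof.
  intros hb hW hn heq; apply Rnot_lt_le; intros hq.
  set (B := Cmod W) in *.
  assert (hB2 : B ^ 2 = Re W ^ 2 + Im W ^ 2) by apply Cmod2_alt.
  destruct W as [x y]; destruct q as [s t].
  unfold Re, Im in *; simpl fst in *; simpl snd in *.
  assert (h1 : k * x = s * (1 + x) - t * y).
  { assert (h := f_equal fst heq); simpl in h; lra. }
  assert (h2 : k * y = s * y + t * (1 + x)).
  { assert (h := f_equal snd heq); simpl in h; lra. }
  clear heq.
  (* Since x / (1 + x) increases, [n] and [b] may be replaced by the larger [k] and [B]. *)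
  assert (hs : s * (1 + B) < k * B).
  { apply Rlt_div_r in hq; [|lra].
    assert (h : 0 <= (k - n) * (1 + b)) by (apply Rmult_le_pos; lra).
    assert (s < k * b / (1 + b)).
    { apply Rlt_div_r; [lra|]; nra. }
    apply Rlt_le_trans with (k * b / (1 + b) * (1 + B)).
    - apply Rmult_lt_compat_r; lra.
    - apply Rle_trans with (k * (b * (1 + B)) / (1 + b)); [right; field; lra|].
      apply Rle_div_l; [lra|].
      rewrite Rmult_assoc; apply Rmult_le_compat_l; nra. }
  assert (hx : x <= B) by nra.
  (* [D] is |1 + W|^2; multiplying the equation by the conjugate of 1 + W isolates the real part [s]
     of [q]. *)
  set (D := (1 + x) ^ 2 + y ^ 2).
  assert (hDeq : s * D = k * (x + B ^ 2)).
  { unfold D; rewrite hB2.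
    transitivity ((s * (1 + x) - t * y) * (1 + x) + (s * y + t * (1 + x)) * y);
      [ring|rewrite <- h1, <- h2; ring]. }
  assert (hD0 : D = 1 + 2 * x + B ^ 2) by (unfold D; rewrite hB2; ring).
  (* If 1 + W were 0, the equation would force k W = 0 with W = -1 and [k] positive. *)
  assert (hD : 0 < D).
  { apply Rnot_le_lt; intros hD.
    assert (hx2 := pow2_ge_0 (1 + x)); assert (hy2 := pow2_ge_0 y).
    unfold D in hD.
    assert (hx0 : (1 + x) ^ 2 = 0) by lra; assert (hy0 : y ^ 2 = 0) by lra.
    assert (x = -1) by nra; assert (y = 0) by nra; subst x y.
    nra. }
  assert (hlt : (s * (1 + B)) * D < k * B * D) by now apply Rmult_lt_compat_r.
  replace (s * (1 + B) * D) with (k * ((x + B ^ 2) * (1 + B))) in hlt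
    by (rewrite <- Rmult_assoc, <- hDeq; ring).
  rewrite Rmult_assoc in hlt.
  apply Rmult_lt_reg_l in hlt; [|lra].
  rewrite hD0 in hlt.
  (* This product is exactly (x + B^2)(1 + B) - B D, which [hlt] makes negative. *)
  assert (0 <= (B - 1) * (B - x)) by (apply Rmult_le_pos; lra).
  nra.
Qed.

(** * The class A_{p,n} *)

Lemma Cmult_reg_l (a x y : C) : a <> 0 -> (a * x)%C = (a * y)%C -> x = y.
Proof.
  intros ha h; apply (f_equal (Cmult (/ a))) in h.
  now rewrite !Cmult_assoc, Cinv_l, !Cmult_1_l in h by exact ha.
Qed.

Lemma is_Cderive_ext_loc (f g : C -> C) (z l : C) :
  locally (T := C_UniformSpace) z (fun w => f w = g w) ->
  is_Cderive f z l -> is_Cderive g z l.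
Proof.
  intros h; apply (is_derive_ext_loc (K := C_AbsRing) (V := C_NormedModule)).
  now apply locally_C.
Qed.

Lemma cseries_term_bounded (a : nat -> C) (l : C) : cseries a l ->
  exists M, forall k, Cmod (a k) <= M.
Proof.
  intros hl.
  assert (h : is_lim_seq (fun N => Cmod (sum_n a N)) (Cmod l)).
  { eapply filterlim_comp;
      [exact hl|exact (filterlim_norm (V := C_NormedModule) l)]. }
  apply is_lim_seq_Reals in h.
  destruct (maj_by_pos (fun N => Cmod (sum_n a N))) as [M [_ hM]];
    [now exists (Cmod l)|].
  assert (hM' : forall N, Cmod (sum_n a N) <= M).
  { intros N; eapply Rle_trans; [apply Rle_abs|apply hM]. }
  exists (2 * M); intros [|k].
  - rewrite <- csum_0; assert (h0 := hM' 0%nat).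
    assert (h1 := Cmod_ge_0 (sum_n a 0)); lra.
  - replace (a (S k)) with (sum_n a (S k) + - sum_n a k)%C
      by (rewrite csum_S; cring).
    eapply Rle_trans; [apply Cmod_triangle|].
    rewrite Cmod_opp; assert (h0 := hM' (S k)); assert (h1 := hM' k); lra.
Qed.

(** Convergence at a real point [x] between [r] and 1 bounds the terms; dividing by [x ^ N] bounds
    |c_k| x^k, hence |c_k| r^k. *)
Lemma conv_disk_of_series (c : nat -> C) (N : nat) :
  (forall z, Cmod z < 1 -> exists l, cseries (fun k => c k * z ^ (N + k))%C l) ->
  conv_disk c.
Proof.
  intros hc; apply conv_disk_of_radius, CV_radius_ge_1; intros r hr.
  set (x := (r + 1) / 2).
  assert (hx : 0 < x < 1) by (unfold x; lra).
  assert (hmx : Cmod x = x) by (rewrite Cmod_R, Rabs_pos_eq; lra).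
  destruct (hc (RtoC x)) as [l hl]; [lra|].
  destruct (cseries_term_bounded _ _ hl) as [M hM].
  assert (hxN : 0 < x ^ N) by (apply pow_lt; lra).
  exists (M / x ^ N); intros k.
  assert (hck := Cmod_ge_0 (c k)).
  rewrite Rabs_pos_eq by (apply Rmult_le_pos; [exact hck|apply pow_le; lra]).
  apply (proj1 (Rle_div_r _ _ _ hxN)).
  eapply Rle_trans; [|apply (hM k)].
  rewrite Cmod_mult, Cmod_pow, hmx, pow_add.
  rewrite Rmult_assoc; apply Rmult_le_compat_l; [exact hck|].
  rewrite Rmult_comm; apply Rmult_le_compat_l; [lra|].
  apply pow_incr; unfold x; lra.
Qed.

(** Supplies the factorisation of the derivative through [W z = z ^ n * cps b z], to which [jack]
    applies. *)
Lemma class_A_derive (p n : nat) (f : C -> C) : (1 <= p)%nat -> (1 <= n)%nat ->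
  class_A p n f ->
  exists b, conv_disk b /\ forall z, Cmod z < 1 ->
    C_derive f z = (INR p * z ^ (p - 1) * (1 + z ^ n * cps b z))%C.
Proof.
  intros hp hn [_ [a ha]].
  set (N := (n + p)%nat).
  set (A := fun k => a (N + k)%nat).
  assert (hA : conv_disk A).
  { apply (conv_disk_of_series A N); intros z hz.
    exists (f z - z ^ p)%C; now apply ha. }
  assert (hf : forall z, Cmod z < 1 -> f z = (z ^ p + z ^ N * cps A z)%C).
  { intros z hz.
    assert (h : (f z - z ^ p)%C = (z ^ N * cps A z)%C).
    { apply (cseries_unique _ _ _ (ha z hz)).
      apply (is_series_ext (K := C_AbsRing) (V := C_NormedModule)
        (fun k => z ^ N * (A k * z ^ k))%C).
      - intros k; unfold A, N; rewrite !Cpow_add_r; cring.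
      - apply (is_series_scal (K := C_AbsRing) (V := C_NormedModule) (z ^ N)%C).
        now apply cps_correct. }
    rewrite <- h; cring. }
  assert (hp0 : RtoC (INR p) <> 0).
  { intros h; apply RtoC_inj in h; apply (not_0_INR p); [lia|exact h]. }
  (* Differentiating A_k z^(N+k) gives (N + k) A_k z^(N+k-1); taking out p z^(p-1) z^n leaves b_k
     z^k, because N - 1 = (p - 1) + n. *)
  set (b := fun k => (RtoC (INR (N + k)) / RtoC (INR p) * A k)%C).
  assert (hb : conv_disk b).
  { apply (conv_disk_le (fun k => INR (S k) * A k)%C _ (INR N / INR p)).
    - intros k; unfold b.
      assert (hp1 : 0 < INR p) by (apply lt_0_INR; lia).
      rewrite !Cmod_mult, Cmod_div, !Cmod_R, !Rabs_pos_eq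
        by (exact hp0 || apply pos_INR).
      rewrite <- Rmult_assoc; apply Rmult_le_compat_r; [apply Cmod_ge_0|].
      apply Rle_div_l; [exact hp1|].
      replace (INR N / INR p * INR (S k) * INR p) with (INR N * INR (S k))
        by (field; lra).
      rewrite <- mult_INR; apply le_INR.
      assert (1 <= N)%nat by (unfold N; lia); nia.
    - now apply conv_disk_INR. }
  exists b; split; [exact hb|].
  intros z hz.
  assert (hbz : (INR p * cps b z)%C =
                (INR N * cps A z + z * cps (cps_derive A) z)%C).
  { apply (cseries_unique (fun k => INR p * (b k * z ^ k))%C).
    - apply (is_series_scal (K := C_AbsRing) (V := C_NormedModule) (RtoC (INR p))).
      now apply cps_correct.
    - apply (is_series_ext (K := C_AbsRing) (V := C_NormedModule)
        (fun k => INR N * (A k * z ^ k) + z * (INR k * A k * z ^ pred k))%C).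
      + intros k; unfold b.
        transitivity ((INR N + INR k) * (A k * z ^ k))%C.
        * destruct k; simpl; cring.
        * rewrite plus_INR, RtoC_plus.
          change (((INR N + INR k) * (A k * z ^ k))%C =
            (INR p * ((INR N + INR k) / INR p * A k * z ^ k))%C).
          field; exact hp0.
      + apply (is_series_plus (K := C_AbsRing) (V := C_NormedModule)).
        * apply (is_series_scal (K := C_AbsRing) (V := C_NormedModule)
            (RtoC (INR N))).
          now apply cps_correct.
        * apply (is_series_scal (K := C_AbsRing) (V := C_NormedModule) z).
          now apply cps_derive_series. }
  apply is_C_derive_unique.
  apply (is_Cderive_ext_loc (fun w => w ^ p + w ^ N * cps A w)%C).
  { generalize (Cmod_lt_locally z 1 hz); apply filter_imp.
    intros w hw; symmetry; now apply hf. }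
  replace (INR p * z ^ (p - 1) * (1 + z ^ n * cps b z))%C with
    (INR p * z ^ pred p + (INR N * z ^ pred N * cps A z
       + z ^ N * cps (cps_derive A) z))%C.
  - apply is_Cderive_plus; [apply is_Cderive_pow|].
    apply is_Cderive_mult; [apply is_Cderive_pow|now apply is_Cderive_cps].
  - transitivity (INR p * z ^ (p - 1) + z ^ (p - 1) * z ^ n * (INR p * cps b z))%C;
      [|cring].
    rewrite hbz, <- Cpow_add_r.
    replace (pred p) with (p - 1)%nat by lia.
    replace (pred N) with (p - 1 + n)%nat by (unfold N; lia).
    replace (z ^ N)%C with (z ^ (p - 1 + n) * z)%C; [cring|].
    rewrite Cmult_comm, <- Cpow_S; f_equal; unfold N; lia.
Qed.

(** * Holomorphic functions on the disk and values of quotients *)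

Definition holo (f : C -> C) : Prop :=
  forall z, Cmod z < 1 -> exists l, is_Cderive f z l.

Lemma holo_mult (f g : C -> C) :
  holo f -> holo g -> holo (fun z => f z * g z)%C.
Proof.
  intros hf hg z hz; destruct (hf z hz) as [l hl]; destruct (hg z hz) as [m hm].
  eexists; apply is_Cderive_mult; eassumption.
Qed.

Lemma holo_plus (f g : C -> C) :
  holo f -> holo g -> holo (fun z => f z + g z)%C.
Proof.
  intros hf hg z hz; destruct (hf z hz) as [l hl]; destruct (hg z hz) as [m hm].
  eexists; apply is_Cderive_plus; eassumption.
Qed.

Lemma holo_const (c : C) : holo (fun _ => c).
Proof. intros z _; eexists; apply is_Cderive_const. Qed.

Lemma holo_id : holo (fun z => z).
Proof. intros z _; eexists; apply is_Cderive_id. Qed.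

Lemma holo_pow (n : nat) : holo (fun z => z ^ n)%C.
Proof. intros z _; eexists; apply is_Cderive_pow. Qed.

Lemma holo_cps (c : nat -> C) : conv_disk c -> holo (cps c).
Proof. intros hc z hz; eexists; now apply is_Cderive_cps. Qed.

(** Intended for [C_derive f] and its derivative, whose formulas are known only inside the disk; the
    disk being open, local agreement suffices. *)
Lemma holo_cont (f g : C -> C) (z : C) : Cmod z < 1 -> holo g ->
  (forall w, Cmod w < 1 -> f w = g w) ->
  filterlim f (locally (T := C_UniformSpace) z) (locally (f z)).
Proof.
  intros hz hg hfg; destruct (hg z hz) as [l hl].
  apply (is_Cderive_cont f z l), (is_Cderive_ext_loc g); [|exact hl].
  generalize (Cmod_lt_locally z 1 hz); apply filter_imp.
  intros w hw; symmetry; now apply hfg.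
Qed.

Lemma C_filterlim_mult {T : Type} (F : (T -> Prop) -> Prop) {FF : Filter F}
  (f g : T -> C) (a b : C) :
  filterlim f F (locally (T := C_UniformSpace) a) ->
  filterlim g F (locally (T := C_UniformSpace) b) ->
  filterlim (fun t => f t * g t)%C F (locally (T := C_UniformSpace) (a * b)%C).
Proof.
  intros hf hg.
  assert (hf' : filterlim f F (locally (T := AbsRing_UniformSpace C_AbsRing) a)).
  { intros P hP; apply hf, locally_C, hP. }
  assert (hg' : filterlim g F (locally (T := AbsRing_UniformSpace C_AbsRing) b)).
  { intros P hP; apply hg, locally_C, hP. }
  intros P hP; apply locally_C in hP.
  exact (filterlim_comp_2 f g (mult (K := C_AbsRing)) hf' hg'
           (filterlim_mult (K := C_AbsRing) a b) P hP).
Qed.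

(** Near [z] but off it, [F] is [F / G] times [G]; both sides have limits, and limits are unique.
    This clears the denominator even where [G z] is 0. *)
Lemma quotient_value_mult (F G : C -> C) (z v : C) :
  filterlim F (locally (T := C_UniformSpace) z) (locally (F z)) ->
  filterlim G (locally (T := C_UniformSpace) z) (locally (G z)) ->
  quotient_value F G z v -> F z = (v * G z)%C.
Proof.
  intros hF hG [hne hv].
  assert (hle : filter_le (locally' (T := C_UniformSpace) z) (locally z))
    by apply filter_le_within.
  rewrite <- (is_C_lim_unique F z (F z)
    (filterlim_filter_le_1 F hle hF)).
  apply is_C_lim_unique.
  apply (filterlim_ext_loc (fun w => F w / G w * G w)%C).
  - generalize hne; apply filter_imp; intros w hw; field; exact hw.
  - apply (C_filterlim_mult _ _ _ _ _ hv), (filterlim_filter_le_1 G hle hG).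
Qed.

Lemma C_derive_factored (p n : nat) (b : nat -> C) (F : C -> C) (z : C) :
  (1 <= p)%nat -> conv_disk b -> Cmod z < 1 ->
  (forall w, Cmod w < 1 ->
     F w = (INR p * w ^ (p - 1) * (1 + w ^ n * cps b w))%C) ->
  C_derive F z = (INR p * (INR (p - 1) * z ^ pred (p - 1)) * (1 + z ^ n * cps b z)
    + INR p * z ^ (p - 1) * (INR n * z ^ pred n * cps b z
        + z ^ n * cps (cps_derive b) z))%C.
Proof.
  intros hp hb hz hF; apply is_C_derive_unique.
  apply (is_Cderive_ext_loc
    (fun w => INR p * w ^ (p - 1) * (1 + w ^ n * cps b w))%C).
  { generalize (Cmod_lt_locally z 1 hz); apply filter_imp.
    intros w hw; symmetry; now apply hF. }
  apply (is_Cderive_mult (fun w => INR p * w ^ (p - 1))%C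
           (fun w => 1 + w ^ n * cps b w)%C).
  - replace (INR p * (INR (p - 1) * z ^ pred (p - 1)))%C with
      (0 * z ^ (p - 1) + INR p * (INR (p - 1) * z ^ pred (p - 1)))%C by cring.
    apply (is_Cderive_mult (fun _ => RtoC (INR p)) (fun w => w ^ (p - 1))%C);
      [apply is_Cderive_const|apply is_Cderive_pow].
  - replace (INR n * z ^ pred n * cps b z + z ^ n * cps (cps_derive b) z)%C with
      (0 + (INR n * z ^ pred n * cps b z + z ^ n * cps (cps_derive b) z))%C
      by cring.
    apply (is_Cderive_plus (fun _ => RtoC 1) (fun w => w ^ n * cps b w)%C);
      [apply is_Cderive_const|].
    apply is_Cderive_mult; [apply is_Cderive_pow|now apply is_Cderive_cps].
Qed.

Theorem theorem2p2 (p n : nat) (alpha : R) (f : C -> C)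
    (hp : (1 <= p)%nat) (hn : (1 <= n)%nat) (halpha : 0 <= alpha < 1)
    (hf : class_A p n f)
    (hRe : forall z : C, unit_disk z ->
       exists v : C,
         quotient_value (fun w : C => (w * C_derive (C_derive f) w)%C)
                        (C_derive f) z v /\
         Re (1 + v)%C <
           ((INR p + INR n) * alpha + (2 * INR p + INR n)) / (alpha + 2)) :
  forall z : C, unit_disk z ->
    exists v : C,
      quotient_value (C_derive f)
                     (fun w : C => (RtoC (INR p) * w ^ (p - 1))%C) z v /\
      Cmod (v - 1)%C < 1 + alpha.
Proof.
  destruct (class_A_derive p n f hp hn hf) as [b [hb hder]].
  assert (hp0 : RtoC (INR p) <> 0).
  { intros h; apply RtoC_inj in h; apply (not_0_INR p); [lia|exact h]. }
  assert (hn0 : 0 < INR n) by (apply lt_0_INR; lia).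
  assert (hG : holo (fun w => 1 + w ^ n * cps b w)%C).
  { apply holo_plus; [apply holo_const|].
    apply holo_mult; [apply holo_pow|now apply holo_cps]. }
  intros z hz; unfold unit_disk in hz.
  exists (1 + z ^ n * cps b z)%C; split.
  (* The denominator can vanish only at 0, which either is the excluded centre or lies at distance
     |z| from it. *)
  - assert (hnz : locally' (T := C_UniformSpace) z
              (fun w => (INR p * w ^ (p - 1))%C <> 0)).
    { destruct (Ceq_dec z 0) as [-> | hz0].
      - exists (mkposreal 1 Rlt_0_1); intros w _ hw.
        apply Cmult_neq_0; [exact hp0|now apply Cpow_nz].
      - apply filter_le_within.
        apply Cmod_gt_0 in hz0.
        apply locally_C; exists (mkposreal _ hz0); intros w hw.
        change (Cmod (w - z) < Cmod z) in hw.
        apply Cmult_neq_0; [exact hp0|apply Cpow_nz].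
        intros ->; replace (0 - z)%C with (- z)%C in hw by cring.
        rewrite Cmod_opp in hw; lra. }
    split; [exact hnz|].
    apply (filterlim_ext_loc (fun w => 1 + w ^ n * cps b w)%C).
    + assert (hd : locally' (T := C_UniformSpace) z (fun w => Cmod w < 1))
        by now apply filter_le_within, Cmod_lt_locally.
      generalize (filter_and _ _ hnz hd); apply filter_imp; intros w [hw hw1].
      rewrite hder by exact hw1; field; split; [|exact hp0].
      intros h; apply hw; rewrite h; ring.
    + eapply filterlim_filter_le_1; [apply filter_le_within|].
      exact (holo_cont _ _ z hz hG (fun _ _ => eq_refl)).
  - replace (1 + z ^ n * cps b z - 1)%C with (z ^ n * cps b z)%C by ring.
    apply Rnot_le_lt; intros hge.
    (* [W] vanishes at 0 because [n >= 1]. *)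
    assert (hz0 : z <> 0).
    { intros ->; rewrite Cmod_mult, Cmod_pow, Cmod_0, pow_i in hge by lia; lra. }
    assert (hb0 : cps b z <> 0).
    { intros h; rewrite h, Cmult_0_r, Cmod_0 in hge; lra. }
    destruct (jack b z hb hz hz0 hb0) as [z0 [m [hmod [hle [hm hjack]]]]].
    assert (hz1 : Cmod z0 < 1) by lra.
    destruct (hRe z0 hz1) as [v [hv hvlt]].
    assert (hder2 := fun w hw =>
      C_derive_factored p n b (C_derive f) w hp hb hw hder).
    (* Only the equation z0 f''(z0) = v f'(z0) is kept from the quotient; the two continuity
       premises are settled at the end. *)
    apply quotient_value_mult in hv.
    + set (W := (z0 ^ n * cps b z0)%C).
      (* The factorisation gives (v - (p - 1)) (1 + W) = z0 W'(z0), which Jack's lemma equates with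
         (n + m) W. Thus [v - (p - 1)] is the [q] of [re_ratio_bound] with k = n + m. *)
      apply (Rlt_not_le (INR n * (1 + alpha) / (1 + (1 + alpha)))
               (Re (v - INR (p - 1)))).
      2: apply (re_ratio_bound W (v - INR (p - 1))%C (INR n + m) (INR n) (1 + alpha)).
      * unfold Cminus; rewrite re_plus, re_opp, re_RtoC.
        rewrite re_plus, re_RtoC in hvlt.
        rewrite minus_INR by exact hp; simpl (INR 1).
        (* The assumed bound is p + n beta / (1 + beta) with beta = 1 + alpha. *)
        replace (((INR p + INR n) * alpha + (2 * INR p + INR n)) / (alpha + 2))
          with (INR p + INR n * (1 + alpha) / (1 + (1 + alpha))) in hvlt
          by (field; lra).
        lra.
      * lra.
      * eapply Rle_trans; [exact hge|].
        unfold W; rewrite !Cmod_mult, !Cmod_pow, hmod.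
        apply Rmult_le_compat_l; [apply pow_le, Cmod_ge_0|exact hle].
      * lra.
      * assert (hz00 : z0 <> 0).
        { apply Cmod_gt_0; rewrite hmod; now apply Cmod_gt_0. }
        rewrite hder2, hder in hv by exact hz1.
        assert (hcancel : (INR p * z0 ^ (p - 1))%C <> 0)
          by (apply Cmult_neq_0; [exact hp0|now apply Cpow_nz]).
        (* The factor [z0] restores the power lost to [pred]; for [k = 0] the coefficient makes both
           sides 0. *)
        assert (hpw : forall k, (INR k * (z0 * z0 ^ pred k))%C = (INR k * z0 ^ k)%C).
        { intros [|k]; simpl; ring. }
        assert (h : (INR p * z0 ^ (p - 1) *
          (INR (p - 1) * (1 + W) + INR n * W
            + z0 ^ n * (z0 * cps (cps_derive b) z0)))%C
          = (INR p * z0 ^ (p - 1) * (v * (1 + W)))%C).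
        { transitivity (v * (INR p * z0 ^ (p - 1) * (1 + z0 ^ n * cps b z0)))%C;
            [|unfold W; ring].
          rewrite <- hv.
          transitivity (INR p * (INR (p - 1) * (z0 * z0 ^ pred (p - 1)))
             * (1 + z0 ^ n * cps b z0)
             + INR p * z0 ^ (p - 1) * (INR n * (z0 * z0 ^ pred n) * cps b z0
                + z0 ^ n * (z0 * cps (cps_derive b) z0)))%C; [|ring].
          rewrite !hpw; unfold W; ring. }
        assert (h2 : (INR (p - 1) * (1 + W) + INR n * W
                      + z0 ^ n * (z0 * cps (cps_derive b) z0))%C = (v * (1 + W))%C).
        { exact (Cmult_reg_l _ _ _ hcancel h). }
        rewrite hjack in h2.
        rewrite RtoC_plus.
        transitivity (v * (1 + W) - INR (p - 1) * (1 + W))%C; [|ring].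
        rewrite <- h2; unfold W; ring.
    + apply (holo_cont (fun w => w * C_derive (C_derive f) w)%C (fun w =>
        w * (INR p * (INR (p - 1) * w ^ pred (p - 1)) * (1 + w ^ n * cps b w) +
          INR p * w ^ (p - 1) * (INR n * w ^ pred n * cps b w
            + w ^ n * cps (cps_derive b) w)))%C z0 hz1);
        [|intros w hw; now rewrite hder2].
      repeat match goal with
        | |- holo (fun w => Cplus _ _) => apply holo_plus
        | |- holo (fun w => Cmult _ _) => apply holo_mult
        | |- holo (fun w => Cpow _ _) => apply holo_pow
        | |- holo (fun w => RtoC _) => apply holo_const
        | |- holo (fun w => w) => apply holo_id
        | |- holo _ => apply holo_cps
        end; trivial; now apply conv_disk_derive.
    + eapply holo_cont; [exact hz1| |exact hder].
      apply holo_mult; [|exact hG].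
      apply holo_mult; [apply holo_const|apply holo_pow].
Qed.
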